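(* Let $R=\mathbb{K}[x_1,\ldots,x_d]$ be a polynomial ring over a field $\mathbb{K}$ (of arbitrary characteristic), and let $G=\mathbb{Z}/2\mathbb{Z}$ act linearly on $R$. Let $I_G=\bigcap_{g\in G}(y_1-g(x_1),\ldots,y_d-g(x_d))\subseteq S=\mathbb{K}[x_1,\ldots,x_d,y_1,\ldots,y_d]$ be the Derksen ideal. Then $I_G^{(n)}=I_G^n$ for every $n\geq 1$.
   Context: A group $G$ acts linearly on $R=\mathbb{K}[x_1,\ldots,x_d]$ if it acts by ring automorphisms such that $g(a)=a$ for every $a\in\mathbb{K}$, $g\in G$, and $g(x_i)$ is a homogeneous linear polynomial (degree-one form) for every $i=1,\ldots,d$ and $g\in G$. Symbolic powers: for an ideal $I\subseteq S$, the $n$-th symbolic power is $I^{(n)}=\bigcap_{\mathfrak{p}\in\mathrm{Ass}(S/I)}(I^nS_{\mathfrak{p}}\cap S)$, where $\mathrm{Ass}(S/I)$ is the set of associated primes of $I$ and $I^nS_{\mathfrak{p}}\cap S$ denotes the preimage of $I^nS_{\mathfrak{p}}$ under $S\to S_{\mathfrak{p}}$. *)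

(* Defs.v *)
From HB Require Import structures.
From mathcomp Require Import all_boot all_fingroup all_algebra.
From mathcomp.multinomials Require Export mpoly.

Set Implicit Arguments.
Unset Strict Implicit.
Unset Printing Implicit Defensive.

Import GRing.Theory.
Local Open Scope ring_scope.

Local Notation "x %:F" := (tofrac x).

(* Ideals are Prop-valued predicates: the idealr structure of ring_quotient is
   restricted to proper ideals with decidable membership. *)

(* [B] is meant to be (the carrier of) a subring of [A]; [I] is an ideal of
   the ring [B]. *)
Definition ideal_of (A : comNzRingType) (B I : A -> Prop) : Prop :=
  [/\ forall x, I x -> B x,
      I 0,
      forall x y, I x -> I y -> I (x + y)
    & forall b x, B b -> I x -> I (b * x)].

(* Smallest ideal of [B] that contains the subset [X] of [B]. *)
Definition ideal_gen_of (A : comNzRingType) (B X : A -> Prop) : A -> Prop :=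
  fun x => forall I : A -> Prop,
    ideal_of B I -> (forall y, X y -> I y) -> I x.

Definition whole (A : comNzRingType) : A -> Prop := fun _ => True.

Definition ideal (A : comNzRingType) (I : A -> Prop) : Prop :=
  ideal_of (@whole A) I.

Definition ideal_gen (A : comNzRingType) (X : A -> Prop) : A -> Prop :=
  ideal_gen_of (@whole A) X.

Definition ideal_pow (A : comNzRingType) (I : A -> Prop) (n : nat) :
    A -> Prop :=
  ideal_gen (fun x => exists2 u : 'I_n -> A,
    forall i, I (u i) & x = \prod_(i < n) u i).

Definition prime_ideal (A : comNzRingType) (p : A -> Prop) : Prop :=
  [/\ ideal p,
      ~ p 1
    & forall x y, p (x * y) -> p x \/ p y].

(* p is in Ass(A/I): p is a prime ideal that is the annihilator of some element
   of the A-module A/I.  The annihilator of the class of z in A/I is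
   {a | a z \in I}. *)
Definition associated_prime (A : comNzRingType) (I p : A -> Prop) : Prop :=
  prime_ideal p /\ exists z : A, forall a, p a <-> I (a * z).

(* The localization A_p of the domain A at the prime p, realized as the subring
   of the fraction field of A formed by the a/s with s not in p; the map from A
   to A_p is then x |-> x%:F. *)
Definition localization (A : idomainType) (p : A -> Prop) :
    {fraction A} -> Prop :=
  fun z => exists a s : A, ~ p s /\ z = a%:F / s%:F.

(* The ideal I A_p of A_p. *)
Definition local_extension (A : idomainType) (p I : A -> Prop) :
    {fraction A} -> Prop :=
  ideal_gen_of (localization p) (fun z => exists2 x : A, I x & z = x%:F).

Definition symbolic_pow (A : idomainType) (I : A -> Prop) (n : nat) :
    A -> Prop :=
  fun x => forall p : A -> Prop, associated_prime I p ->
    local_extension p (ideal_pow I n) x%:F.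

(* MathComp actions are right actions: to (to f g) h = to f (g * h).  This is
   immaterial for an abelian group such as Z/2Z.  The maps f |-> to f g are
   bijective because to is a group action, so that ring morphisms are ring
   automorphisms. *)
Definition linear_action (K : fieldType) (d : nat) (gT : finGroupType)
    (to : {action gT &-> {mpoly K[d]}}) : Prop :=
  forall g : gT,
    [/\ zmod_morphism (fun f => to f g),
        monoid_morphism (fun f => to f g),
        forall a : K, to a%:MP g = a%:MP
      & forall i : 'I_d, to 'X_i g \is 1.-homog].

(* K[x_1, ..., x_d, y_1, ..., y_d] is {mpoly K[d + d]}. *)
Definition xvar (K : fieldType) (d : nat) (i : 'I_d) : {mpoly K[d + d]} :=
  'X_(lshift d i).

Definition yvar (K : fieldType) (d : nat) (i : 'I_d) : {mpoly K[d + d]} :=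
  'X_(rshift d i).

(* The inclusion of K[x_1, ..., x_d] into K[x_1, ..., x_d, y_1, ..., y_d]. *)
Definition xincl (K : fieldType) (d : nat) (f : {mpoly K[d]}) :
    {mpoly K[d + d]} :=
  f \mPo [tuple xvar K i | i < d].

Definition Derksen_ideal (K : fieldType) (d : nat) (gT : finGroupType)
    (to : {action gT &-> {mpoly K[d]}}) : {mpoly K[d + d]} -> Prop :=
  fun f => forall g : gT,
    ideal_gen (fun u => exists i : 'I_d, u = yvar K i - xincl (to 'X_i g)) f.

(* Main.v *)
(* The Derksen ideal is the intersection of two primes generated by linear
   forms, (y - x) and (y - gx).  Write gx = x + Ax and A = L E U with L and U
   invertible and E = diag(1, ..., 1, 0, ..., 0) of rank r.  In the coordinates
   a = L^-1 (y - x) and b = a - Ux, these primes are (a_1, ..., a_d) and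
   (b_1, ..., b_r, a_{r+1}, ..., a_d).  Both are generated by variables, so that
   their powers are primary and the n-th symbolic power of the intersection lies
   in the intersection of their n-th powers.  The latter is spanned by the
   monomials of degree at least n in each of the two sets of variables, from
   which n factors of the form c (c in both sets) or a b (a in the first set, b
   in the second) can be extracted. *)
Require Import Defs.
From HB Require Import structures.
From mathcomp Require Import all_boot all_fingroup all_algebra.

Set Implicit Arguments.
Unset Strict Implicit.
Unset Printing Implicit Defensive.

Import GRing.Theory.
Local Open Scope ring_scope.

(** * Ideals, their powers and localization *)

Lemma idealMl (A : comNzRingType) (J : A -> Prop) (b x : A) :
  ideal J -> J x -> J (b * x).
Proof. by case=> _ _ _; apply. Qed.

Lemma ideal_gen_ideal (A : comNzRingType) (X : A -> Prop) :
  ideal (ideal_gen X).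
Proof.
split=> // [J [_ J0 _ _] _|x y Xx Xy J idJ XJ|b x _ Xx J idJ XJ] //.
  by case: (idJ) => _ _ JD _; apply: JD; [apply: Xx | apply: Xy].
by case: (idJ) => _ _ _ JM; apply: JM => //; apply: Xx.
Qed.

Lemma ideal_gen_sub (A : comNzRingType) (X J : A -> Prop) :
  ideal J -> (forall x, X x -> J x) -> forall x, ideal_gen X x -> J x.
Proof. by move=> idJ XJ x; apply. Qed.

Lemma ideal_sum (A : comNzRingType) (J : A -> Prop) (T : eqType) (r : seq T)
    (F : T -> A) :
  ideal J -> (forall i, i \in r -> J (F i)) -> J (\sum_(i <- r) F i).
Proof.
case=> _ J0 JD _ JF; rewrite big_seq.
by apply: big_ind => // x y; apply: JD.
Qed.

Lemma ideal_preim_mul (A : comNzRingType) (J : A -> Prop) (y : A) :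
  ideal J -> ideal (fun x => J (x * y)).
Proof.
case=> _ J0 JD JM; split=> // [|x z Jx Jz|b x _ Jx]; first by rewrite mul0r.
  by rewrite mulrDl; apply: JD.
by rewrite -mulrA; apply: JM.
Qed.

Lemma ideal_pow0 (A : comNzRingType) (J : A -> Prop) (x : A) :
  ideal_pow J 0 x.
Proof.
rewrite -[x]mulr1; apply: (idealMl x (ideal_gen_ideal _)).
move=> K _; apply.
by exists (fun=> 0) => [[]|] //; rewrite big_ord0.
Qed.

(** For fixed [y], the [x] with [x * y] in the next power form an ideal, so it suffices to treat
    products of [n] elements of [J]. *)
Lemma ideal_powS (A : comNzRingType) (J : A -> Prop) (n : nat) (x y : A) :
  ideal_pow J n x -> J y -> ideal_pow J n.+1 (x * y).
Proof.
move=> Jx Jy; apply: (ideal_gen_sub (J := fun x => ideal_pow J n.+1 (x * y)))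
  Jx; first exact/ideal_preim_mul/ideal_gen_ideal.
move=> _ [u Ju ->] K _; apply.
(* [unlift ord_max i] is [None] only at the last index, where the default [y] enters. *)
exists (fun i => oapp u y (unlift ord_max i)) => [i|].
  by case: unliftP => [j _|_] //=.
rewrite big_ord_recr /= unlift_none /=; congr (_ * _).
apply: eq_bigr => i _; suff ->: widen_ord (leqnSn n) i = lift ord_max i.
  by rewrite liftK.
by apply/val_inj; rewrite /= /bump leqNgt ltn_ord.
Qed.

(** The fractions with numerator in [J] and denominator outside [p] form an ideal of the
    localization that contains the image of [J]. Clearing the denominator of such an expression for
    [x] gives [s]. *)
Lemma local_extensionP (A : idomainType) (p J : A -> Prop) (x : A) :
  prime_ideal p -> ideal J -> local_extension p J (tofrac x) ->
  exists2 s, ~ p s & J (s * x).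
Proof.
move=> [idp p1 pM] [_ J0 JD JM] /(_ (fun z => exists a s : A,
  [/\ J a, ~ p s & z = tofrac a / tofrac s])).
have [_ p0 _ _] := idp.
have nzs s : ~ p s -> tofrac s != 0.
  by move=> ps; rewrite tofrac_eq0; apply/eqP => s0; apply: ps; rewrite s0.
case=> [|z [a Ja ->]|a [s [Ja ps]]]; last 1 first.
- move=> /(congr1 ( *%R^~ (tofrac s))) /=; rewrite divfK ?nzs // => /eqP.
  by rewrite -rmorphM tofrac_eq => /eqP xs; exists s => //; rewrite mulrC xs.
- split=> [z [a [s [_ ps ->]]]||z z' [a [s [Ja ps ->]]] [a' [s' [Ja' ps' ->]]]|
    _ z [b [t [pt ->]]] [a [s [Ja ps ->]]]].
  + by exists a, s.
  + by exists 0, 1; split=> //; rewrite rmorph0 mul0r.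
  + exists (a * s' + a' * s), (s * s'); split=> [||].
    * by apply: JD; rewrite mulrC; apply: JM.
    * by case/pM.
    by rewrite addf_div ?nzs // -!rmorphM -rmorphD.
  exists (b * a), (t * s); split=> [||]; first exact: JM.
    by case/pM.
  by rewrite mulf_div -!rmorphM.
by exists a, 1; split=> //; rewrite rmorph1 divr1.
Qed.

(** * Orders of vanishing *)

(** Divisibility of [theta f] by ['X^n]. When [theta] records the degree in some of the variables,
    this is the [n]-th power of the ideal that they generate. *)
Definition order_ge (A B : idomainType) (theta : A -> {poly B}) (n : nat)
    (f : A) : Prop :=
  forall k, (k < n)%N -> (theta f)`_k = 0.

Lemma order_ge_ideal (A B : idomainType) (theta : {rmorphism A -> {poly B}})
    (n : nat) :
  ideal (order_ge theta n).
Proof.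
split=> // [k _|f g Of Og k kn|b f _ Of k kn].
- by rewrite rmorph0 coef0.
- by rewrite rmorphD coefD Of ?Og ?addr0.
rewrite rmorphM coefM big1 // => i _.
by rewrite Of ?mulr0 // (leq_ltn_trans (leq_subr _ _)).
Qed.

Lemma order_geM (A B : idomainType) (theta : {rmorphism A -> {poly B}})
    (i j : nat) (f g : A) :
  order_ge theta i f -> order_ge theta j g -> order_ge theta (i + j) (f * g).
Proof.
move=> Of Og k kij; rewrite rmorphM coefM big1 // => l _.
have [li|il] := ltnP l i; first by rewrite Of ?mul0r.
rewrite Og ?mulr0 // ltn_subLR; last by rewrite -ltnS.
by rewrite (leq_trans kij) // leq_add2r.
Qed.

(* Comparison of lowest-degree coefficients: this is what makes the powers
   [order_ge theta n] of the prime [order_ge theta 1] primary. *)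
Lemma order_ge_cancel (A B : idomainType) (theta : {rmorphism A -> {poly B}})
    (n : nat) (s f : A) :
  ~ order_ge theta 1 s -> order_ge theta n (s * f) -> order_ge theta n f.
Proof.
move=> Os Osf; have s0 : (theta s)`_0 != 0.
  by apply/eqP => s0; apply: Os => -[].
(* The lower coefficients of [theta f] vanish by induction, which leaves the constant coefficient of
   [theta s] times the [k]-th one of [theta f]. *)
elim/ltn_ind => k IHk kn; have := Osf k kn.
rewrite rmorphM coefM big_ord_recl /= subn0 big1 ?addr0 => [/eqP|i _].
  by rewrite mulf_eq0 (negPf s0) /= => /eqP.
have lt_ik : (k - bump 0 i < k)%N.
  by rewrite ltn_subrL (leq_ltn_trans _ (ltn_ord i)).
by rewrite IHk ?mulr0 // (ltn_trans lt_ik).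
Qed.

(** The ideal is the kernel of the map to the domain [B] that takes [f] to the constant coefficient
    of [theta f]. *)
Lemma order_ge1_prime (A B : idomainType)
    (theta : {rmorphism A -> {poly B}}) :
  prime_ideal (order_ge theta 1).
Proof.
split=> [|/(_ 0%N isT)/eqP|x y Oxy]; first exact: order_ge_ideal.
  by rewrite rmorph1 coef1 oner_eq0.
have [/eqP x0|x0] := boolP ((theta x)`_0 == 0); first by left=> -[].
right; apply: order_ge_cancel Oxy => /(_ 0%N isT) /eqP.
exact/negP.
Qed.

Lemma order_ge_pow (A B : idomainType) (theta : {rmorphism A -> {poly B}})
    (J : A -> Prop) (n : nat) (f : A) :
  (forall x, J x -> order_ge theta 1 x) -> ideal_pow J n f ->
  order_ge theta n f.
Proof.
move=> JO; apply: ideal_gen_sub; first exact: order_ge_ideal.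
move=> _ [u Ju ->]; elim: n u Ju => [|n IHn] u Ju; first by [].
rewrite big_ord_recl.
exact: (order_geM (JO _ (Ju _)) (IHn _ (fun i => Ju (lift ord0 i)))).
Qed.

(** * Symbolic powers of an intersection of two primes *)

(** Since [z] lies outside the first prime and multiplies it into the second, the first prime is the
    annihilator of [z] modulo [J], hence associated. Some [s] outside it then carries [f] into the
    [n]-th power of [J], and [s] can be cancelled. *)
Lemma symbolic_pow_order_ge (A B : idomainType)
    (theta1 theta2 : {rmorphism A -> {poly B}}) (J : A -> Prop) (z : A)
    (n : nat) (f : A) :
  (forall x, J x <-> order_ge theta1 1 x /\ order_ge theta2 1 x) ->
  ~ order_ge theta1 1 z ->
  (forall x, order_ge theta1 1 x -> order_ge theta2 1 (x * z)) ->
  symbolic_pow J n f -> order_ge theta1 n f.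
Proof.
move=> JE Oz zO fJ.
have /fJ {}fJ : associated_prime J (order_ge theta1 1).
  split; first exact: order_ge1_prime.
  exists z => x; rewrite JE; split=> [Ox|[Oxz _]].
    split; last exact: zO.
    by rewrite mulrC; apply: idealMl Ox; apply: (order_ge_ideal theta1).
  by apply: order_ge_cancel Oz _; rewrite mulrC.
have [||s Os Jsf] := local_extensionP _ _ fJ.
- exact: order_ge1_prime.
- exact: ideal_gen_ideal.
by apply: order_ge_cancel Os _; apply: order_ge_pow Jsf => x /JE[].
Qed.

Lemma symbolic_pow_eq (A B : idomainType)
    (theta1 theta2 : {rmorphism A -> {poly B}}) (J : A -> Prop) (z1 z2 : A)
    (n : nat) (f : A) :
  (forall x, J x <-> order_ge theta1 1 x /\ order_ge theta2 1 x) ->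
  ~ order_ge theta1 1 z1 ->
  (forall x, order_ge theta1 1 x -> order_ge theta2 1 (x * z1)) ->
  ~ order_ge theta2 1 z2 ->
  (forall x, order_ge theta2 1 x -> order_ge theta1 1 (x * z2)) ->
  (order_ge theta1 n f -> order_ge theta2 n f -> ideal_pow J n f) ->
  symbolic_pow J n f <-> ideal_pow J n f.
Proof.
move=> JE Oz1 z1O Oz2 z2O OJ; split=> [fJ|fJ p _ K [_ _ _ KM] JK].
  have JE' x : J x <-> order_ge theta2 1 x /\ order_ge theta1 1 x.
    by rewrite JE; split=> -[].
  apply: OJ; first exact: symbolic_pow_order_ge JE Oz1 z1O fJ.
  exact: symbolic_pow_order_ge JE' Oz2 z2O fJ.
by apply: JK; exists f.
Qed.

(** * Linear forms and linear substitutions *)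

Definition lin_form (K : fieldType) (m : nat) (v : 'rV[K]_m) : {mpoly K[m]} :=
  \sum_j v 0 j *: 'X_j.

Lemma lin_form_mul (K : fieldType) (m d : nat) (v : 'rV[K]_d)
    (B : 'M[K]_(d, m)) :
  lin_form (v *m B) = \sum_i v 0 i *: lin_form (row i B).
Proof.
under [RHS]eq_bigr do rewrite scaler_sumr.
rewrite exchange_big; apply: eq_bigr => j _; rewrite mxE scaler_suml.
by apply: eq_bigr => i _; rewrite scalerA mxE.
Qed.

Lemma lin_form_delta (K : fieldType) (m : nat) (i : 'I_m) :
  lin_form (delta_mx 0 i : 'rV[K]_m) = 'X_i.
Proof.
rewrite /lin_form (bigD1 i) //= mxE !eqxx scale1r big1 ?addr0 // => j ji.
by rewrite mxE (negPf ji) andbF scale0r.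
Qed.

Lemma lin_form_homog1 (K : fieldType) (m : nat) (f : {mpoly K[m]}) :
  f \is 1.-homog -> f = lin_form (\row_j f@_U_(j)).
Proof.
move=> fh; apply/mpolyP => u; rewrite /lin_form raddf_sum /=.
under eq_bigr do rewrite mcoeffZ mcoeffX mxE.
have [/mdeg1P[i /eqP ->]|du] := boolP (mdeg u == 1%N).
  rewrite (bigD1 i) //= eqxx mulr1 big1 ?addr0 // => j ji.
  by rewrite eq_mnm1 (negPf ji) mulr0.
rewrite (dhomog_nemf_coeff fh) // big1 // => j _.
case: eqP => [ju|_]; last by rewrite mulr0.
by rewrite -ju mdeg1 in du.
Qed.

Lemma ideal_lin_form (K : fieldType) (m d e : nat) (J : {mpoly K[m]} -> Prop)
    (C : 'M[K]_(e, d)) (B : 'M[K]_(d, m)) :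
  ideal J -> (forall i, J (lin_form (row i B))) ->
  forall j, J (lin_form (row j (C *m B))).
Proof.
move=> idJ JB j; rewrite row_mul lin_form_mul; apply: ideal_sum => // i _.
by rewrite -mul_mpolyC; apply: idealMl.
Qed.

(** Forms are row vectors on which [M] acts from the right, so composing substitutions multiplies
    the matrices in reverse order. *)
Definition lin_subst (K : fieldType) (m : nat) (M : 'M[K]_m)
    (f : {mpoly K[m]}) : {mpoly K[m]} :=
  f \mPo [tuple lin_form (row k M) | k < m].

HB.instance Definition _ (K : fieldType) (m : nat) (M : 'M[K]_m) :=
  GRing.LRMorphism.copy (lin_subst M)
    (comp_mpoly [tuple lin_form (row k M) | k < m]).

Lemma lin_substX (K : fieldType) (m : nat) (M : 'M[K]_m) (i : 'I_m) :
  lin_subst M 'X_i = lin_form (row i M).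
Proof. by rewrite /lin_subst comp_mpolyXU -tnth_nth tnth_mktuple. Qed.

Lemma lin_subst_form (K : fieldType) (m : nat) (M : 'M[K]_m) (v : 'rV[K]_m) :
  lin_subst M (lin_form v) = lin_form (v *m M).
Proof.
rewrite lin_form_mul linear_sum; apply: eq_bigr => i _.
by rewrite linearZ /= lin_substX.
Qed.

Lemma lin_subst_mul (K : fieldType) (m : nat) (M N : 'M[K]_m)
    (f : {mpoly K[m]}) :
  lin_subst M (lin_subst N f) = lin_subst (N *m M) f.
Proof.
rewrite [lin_subst N f]comp_mpolyE linear_sum /= [RHS]comp_mpolyE.
apply: eq_bigr => u _; rewrite linearZ /= rmorph_prod; congr (_ *: _).
apply: eq_bigr => i _.
by rewrite rmorphXn /= !tnth_mktuple lin_subst_form row_mul.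
Qed.

Lemma lin_subst1 (K : fieldType) (m : nat) (f : {mpoly K[m]}) :
  lin_subst 1%:M f = f.
Proof.
rewrite -[RHS]comp_mpoly_id; congr (_ \mPo _); apply: eq_from_tnth => i.
by rewrite !tnth_mktuple row1 lin_form_delta.
Qed.

(** * Gradings by sets of variables *)

Definition weight (m : nat) (T : {set 'I_m}) (u : 'X_{1..m}) : nat :=
  \sum_(i in T) u i.

Lemma weightD (m : nat) (T : {set 'I_m}) (u v : 'X_{1..m}) :
  weight T (u + v) = (weight T u + weight T v)%N.
Proof. by rewrite -big_split; apply: eq_bigr => i _; rewrite mnmDE. Qed.

Lemma weightU (m : nat) (T : {set 'I_m}) (i : 'I_m) :
  weight T U_(i) = (i \in T).
Proof.
rewrite /weight; under eq_bigr do rewrite mnm1E.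
have [iT|iT] := boolP (i \in T).
  by rewrite (bigD1 i) //= eqxx big1 ?addn0 // => j /andP[_ /negPf];
     rewrite eq_sym => ->.
by rewrite big1 // => j jT; case: eqP => // ij; rewrite ij jT in iT.
Qed.

Lemma weight_gt0 (m : nat) (T : {set 'I_m}) (u : 'X_{1..m}) :
  (0 < weight T u)%N -> exists2 i, i \in T & (0 < u i)%N.
Proof.
rewrite lt0n sum_nat_eq0 negb_forall => /existsP[i]; rewrite negb_imply.
by case/andP=> iT; rewrite -lt0n; exists i.
Qed.

(* The degree in ['X] of the image of a monomial is its degree in the variables
   indexed by [T]. *)
Definition grade (K : fieldType) (m : nat) (T : {set 'I_m})
    (f : {mpoly K[m]}) : {poly {mpoly K[m]}} :=
  mmap (polyC \o @mpolyC m K) (fun i => ('X_i)%:P * 'X^(i \in T)) f.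

HB.instance Definition _ (K : fieldType) (m : nat) (T : {set 'I_m}) :=
  GRing.RMorphism.copy (@grade K m T)
    (mmap (polyC \o @mpolyC m K) (fun i => ('X_i)%:P * 'X^(i \in T))).

Lemma gradeX (K : fieldType) (m : nat) (T : {set 'I_m}) (u : 'X_{1..m}) :
  @grade K m T 'X_[u] = 'X_[u]%:P * 'X^(weight T u).
Proof.
rewrite /grade mmapX /mmap1; under eq_bigr do rewrite exprMn.
rewrite big_split /= mpolyXE_id rmorph_prod; congr (_ * _).
  by apply: eq_bigr => i _; rewrite rmorphXn.
rewrite -prodrXr [RHS]big_mkcond; apply: eq_bigr => i _.
by case: (i \in T); rewrite // expr0 expr1n.
Qed.

Lemma gradeZX (K : fieldType) (m : nat) (T : {set 'I_m}) (c : K)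
    (u : 'X_{1..m}) :
  grade T (c *: 'X_[u]) = (c *: 'X_[u])%:P * 'X^(weight T u).
Proof.
by rewrite [LHS]mmapZ -[mmap _ _ _]/(grade T 'X_[u]) gradeX mulrA /= -rmorphM
  mul_mpolyC.
Qed.

(** Thus [grade T] lists the components of [f] by weight, and the order of a nonzero [f] is the
    least weight in its support. *)
Lemma grade_coef (K : fieldType) (m : nat) (T : {set 'I_m})
    (f : {mpoly K[m]}) (k : nat) (u : 'X_{1..m}) :
  (grade T f)`_k@_u = f@_u *+ (k == weight T u).
Proof.
rewrite [in LHS](mpolyE f) [in RHS](mpolyE f) raddf_sum /= coef_sum.
rewrite !raddf_sum -sumrMnl; apply: eq_bigr => v _ /=.
rewrite gradeZX coefCM coefXn mulr_natr mcoeffMn mcoeffZ mcoeffX.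
by case: (v =P u) => [->//|_]; rewrite mulr0 !mul0rn.
Qed.

Lemma grade_weight (K : fieldType) (m : nat) (T : {set 'I_m}) (n : nat)
    (f : {mpoly K[m]}) (u : 'X_{1..m}) :
  order_ge (grade T) n f -> u \in msupp f -> (n <= weight T u)%N.
Proof.
move=> Of uf; rewrite leqNgt; apply/negP => /Of /(congr1 (mcoeff u)).
by rewrite grade_coef eqxx mcoeff0 => /eqP; rewrite mcoeff_eq0 uf.
Qed.

(* Order of vanishing along the linear subspace where the forms [row i M],
   [i \in T], vanish. *)
Definition sub_order (K : fieldType) (m : nat) (M : 'M[K]_m)
    (T : {set 'I_m}) : {mpoly K[m]} -> {poly {mpoly K[m]}} :=
  grade T \o lin_subst (invmx M).

HB.instance Definition _ (K : fieldType) (m : nat) (M : 'M[K]_m)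
    (T : {set 'I_m}) :=
  GRing.RMorphism.copy (sub_order M T) (grade T \o lin_subst (invmx M)).

(** * Ideals generated by coordinates, and their powers *)

Section Coordinates.

Context (K : fieldType) (m : nat) (M : 'M[K]_m) (Mu : M \in unitmx).

Lemma lin_substK : cancel (lin_subst (invmx M)) (lin_subst M).
Proof. by move=> f; rewrite lin_subst_mul mulVmx // lin_subst1. Qed.

Lemma sub_orderX (T : {set 'I_m}) (i : 'I_m) :
  sub_order M T (lin_form (row i M)) = ('X_i)%:P * 'X^(i \in T).
Proof.
rewrite /sub_order /= lin_subst_form -row_mul mulmxV // row1 lin_form_delta.
by rewrite gradeX weightU.
Qed.

Lemma order_geX (T : {set 'I_m}) (i : 'I_m) :
  i \in T -> order_ge (sub_order M T) 1 (lin_form (row i M)).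
Proof. by move=> iT [|//] _; rewrite sub_orderX iT coefMX. Qed.

Lemma order_geXN (T : {set 'I_m}) (i : 'I_m) :
  i \notin T -> ~ order_ge (sub_order M T) 1 (lin_form (row i M)).
Proof.
move=> /negPf iT /(_ 0%N isT); rewrite sub_orderX iT mulr1 coefC /=.
move=> /(congr1 (mcoeff U_(i))) /eqP.
by rewrite mcoeffX eqxx mcoeff0 oner_eq0.
Qed.

(** In the coordinates given by the rows of [M], [f] is a combination of monomials of weight at
    least [n], and membership in [J] need only be tested on these. *)
Lemma sub_order_ideal (T : {set 'I_m}) (n : nat) (J : {mpoly K[m]} -> Prop)
    (f : {mpoly K[m]}) :
  ideal J -> order_ge (sub_order M T) n f ->
  (forall u, (n <= weight T u)%N -> u \in msupp (lin_subst (invmx M) f) ->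
    J (lin_subst M 'X_[u])) ->
  J f.
Proof.
move=> idJ Of JX; rewrite -[f]lin_substK.
rewrite [lin_subst (invmx M) f]mpolyE linear_sum /=.
apply: ideal_sum => // u uf; rewrite linearZ /= -mul_mpolyC.
by apply: idealMl => //; apply: JX => //; apply: grade_weight uf.
Qed.

(** As [L] is invertible, the rows of [B] generate the same ideal as the coordinates selected by
    [s]. *)
Lemma ideal_gen_sub_order (d : nat) (L : 'M[K]_d) (s : 'I_d -> 'I_m)
    (B : 'M[K]_(d, m)) (f : {mpoly K[m]}) :
  L \in unitmx -> B = L *m rowsub s M ->
  ideal_gen (fun x => exists i, x = lin_form (row i B)) f <->
  order_ge (sub_order M [set s i | i in 'I_d]) 1 f.
Proof.
move=> Lu BE; split.
  apply: ideal_gen_sub => [|_ [i ->]]; first exact: order_ge_ideal.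
  rewrite BE; apply: ideal_lin_form => [|j]; first exact: order_ge_ideal.
  by rewrite row_rowsub; apply: order_geX; apply: imset_f.
move=> Of; apply: sub_order_ideal Of _; first exact: ideal_gen_ideal.
(* A monomial of positive weight is divisible by one of the selected variables. *)
move=> u /weight_gt0[_ /imsetP[i _ ->] ui] _.
have le_iu : (U_(s i) <= u)%MM.
  by apply/mnm_lepP => j; rewrite mnm1E; case: eqP => // <-.
rewrite -(submK le_iu) mpolyXD rmorphM.
apply: (idealMl _ (ideal_gen_ideal _)).
have sE : rowsub s M = invmx L *m B by rewrite BE mulKmx.
rewrite /= lin_substX -row_rowsub sE.
apply: (ideal_lin_form _ (ideal_gen_ideal _)).
by move=> j J idJ; apply; exists j.
Qed.

(** Induction on [n]: a factor [v] lying in [J] and of weight at most 1 for both sets is split off,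
    so that each weight drops by at most 1. *)
Lemma monomial_pow (T1 T2 : {set 'I_m}) (J : {mpoly K[m]} -> Prop) (n : nat)
    (u : 'X_{1..m}) :
  (forall x, J x <->
    order_ge (sub_order M T1) 1 x /\ order_ge (sub_order M T2) 1 x) ->
  (n <= weight T1 u)%N -> (n <= weight T2 u)%N ->
  ideal_pow J n (lin_subst M 'X_[u]).
Proof.
move=> JE; elim: n u => [|n IHn] u n1 n2; first exact: ideal_pow0.
have [i iT1 ui] := weight_gt0 (leq_trans (ltn0Sn n) n1).
have [j jT2 uj] := weight_gt0 (leq_trans (ltn0Sn n) n2).
suff [v [le_vu v1 v2 Jv]] : exists v, [/\ (v <= u)%MM, (weight T1 v <= 1)%N,
    (weight T2 v <= 1)%N & J (lin_subst M 'X_[v])].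
  rewrite -(submK le_vu) mpolyXD rmorphM; apply: ideal_powS Jv.
  apply: IHn; rewrite -(leq_add2r 1).
    by rewrite addn1 (leq_trans n1) // -{1}(submK le_vu) weightD leq_add2l.
  by rewrite addn1 (leq_trans n2) // -{1}(submK le_vu) weightD leq_add2l.
have leU k : (0 < u k)%N -> (U_(k) <= u)%MM.
  by move=> uk; apply/mnm_lepP => l; rewrite mnm1E; case: eqP => // <-.
have [iT2|iT2] := boolP (i \in T2).
  exists U_(i)%MM; rewrite leU ?weightU ?leq_b1 //; split=> //.
  by rewrite lin_substX JE; split; apply: order_geX.
have [jT1|jT1] := boolP (j \in T1).
  exists U_(j)%MM; rewrite leU ?weightU ?leq_b1 //; split=> //.
  by rewrite lin_substX JE; split; apply: order_geX.
(* Here [i] lies in [T1] only and [j] in [T2] only, so they differ and the product of the two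
   variables still divides the monomial. *)
exists (U_(i) + U_(j))%MM; split.
- apply/mnm_lepP => l; rewrite mnmDE !mnm1E.
  case: (i =P l) => [il|_]; case: (j =P l) => [jl|_] //=.
  + by rewrite il -jl jT2 in iT2.
  + by rewrite -il.
  by rewrite -jl.
- by rewrite weightD !weightU iT1 (negPf jT1).
- by rewrite weightD !weightU jT2 (negPf iT2).
rewrite mpolyXD rmorphM /= !lin_substX JE; split.
  by rewrite mulrC; apply: idealMl (order_geX iT1); apply: order_ge_ideal.
by apply: idealMl (order_geX jT2); apply: order_ge_ideal.
Qed.

(** The hypothesis says that the two sets are equal or incomparable. In the first case [z] is 1, in
    the second a coordinate from [T2] outside [T1]. *)
Lemma sub_order_sep (T1 T2 : {set 'I_m}) :
  (T2 \subset T1) = (T1 \subset T2) ->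
  exists2 z, ~ order_ge (sub_order M T1) 1 z &
    forall x, order_ge (sub_order M T1) 1 x ->
              order_ge (sub_order M T2) 1 (x * z).
Proof.
have [sT21 /esym sT12|/subsetPn[i iT2 iT1] _] := boolP (T2 \subset T1).
  have -> : T2 = T1 by apply/eqP; rewrite eqEsubset sT21.
  exists 1 => [|x Ox]; last by rewrite mulr1.
  by have [] := order_ge1_prime (sub_order M T1).
exists (lin_form (row i M)) => [|x _]; first exact: order_geXN.
by apply: idealMl (order_geX iT2); apply: order_ge_ideal.
Qed.

Lemma two_subspaces_symbolic_pow (T1 T2 : {set 'I_m})
    (J : {mpoly K[m]} -> Prop) (n : nat) (f : {mpoly K[m]}) :
  (T2 \subset T1) = (T1 \subset T2) ->
  (forall x, J x <->
    order_ge (sub_order M T1) 1 x /\ order_ge (sub_order M T2) 1 x) ->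
  symbolic_pow J n f <-> ideal_pow J n f.
Proof.
move=> T12 JE; have [z1 Oz1 z1O] := sub_order_sep T12.
have [z2 Oz2 z2O] := sub_order_sep (esym T12).
apply: (symbolic_pow_eq JE Oz1 z1O Oz2 z2O) => O1 O2.
apply: sub_order_ideal O1 _; first exact: ideal_gen_ideal.
move=> u wu uf; have wu2 : (n <= weight T2 u)%N by apply: grade_weight uf.
exact: (monomial_pow JE wu wu2).
Qed.

End Coordinates.

(** * Common coordinates for two graphs *)

(** The rows of [a] and of [a - w] are the coordinates. Since [N - 1%:M = L *m pid_mx r *m U], the
    forms [invmx L *m row_mx (- N) 1%:M] equal [a - pid_mx r *m w]: rows of [a - w] below index [r],
    rows of [a] from there on. *)
Lemma normal_form_graph (K : fieldType) (d : nat) (N : 'M[K]_d) :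
  exists L M (s1 s2 : 'I_d -> 'I_(d + d)),
  [/\ L \in unitmx /\ M \in unitmx,
      row_mx (- 1%:M) 1%:M = L *m rowsub s1 M,
      row_mx (- N) 1%:M = L *m rowsub s2 M
    & ([set s2 i | i in 'I_d] \subset [set s1 i | i in 'I_d]) =
      ([set s1 i | i in 'I_d] \subset [set s2 i | i in 'I_d])].
Proof.
pose A := N - 1%:M; pose r := \rank A.
pose L := col_ebase A; pose U := row_ebase A.
have Lu : L \in unitmx := col_ebase_unit A.
have Uu : U \in unitmx := row_ebase_unit A.
pose a : 'M[K]_(d, d + d) := invmx L *m row_mx (- 1%:M) 1%:M.
pose w : 'M[K]_(d, d + d) := row_mx U 0.
pose M := col_mx a (a - w).
pose s2 (i : 'I_d) := if (i < r)%N then rshift d i else lshift d i.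
exists L, M, (@lshift d d), s2; split.
(* [Q] is the inverse of [col_mx a w], and [M] is [col_mx a w] multiplied on the left by the block
   matrix below, which is its own inverse. *)
- split=> //; pose Q := row_mx (col_mx 0 L) (col_mx (invmx U) (invmx U)).
  have aQ : a *m Q = row_mx 1%:M 0.
    rewrite -mulmxA mul_mx_row !mul_row_col mulmx0 add0r mul1mx mulNmx mul1mx.
    by rewrite addNr mul_mx_row mulVmx // mulmx0.
  have wQ : w *m Q = row_mx 0 1%:M.
    by rewrite mul_mx_row !mul_row_col mulmx0 !mul0mx !addr0 mulmxV.
  have /mulmx1_unit[] // : M *m (Q *m block_mx 1%:M 0 1%:M (- 1%:M)) = 1%:M.
  rewrite mulmxA mul_col_mx mulmxBl aQ wQ opp_row_mx add_row_mx.
  rewrite -[col_mx _ _]/(block_mx _ _ _ _) mulmx_block !mul1mx !mul0mx.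
  rewrite !subr0 !sub0r !mulNmx !mulmxN !mul1mx opprK !addr0 !add0r subrr.
  by rewrite -scalar_mx_block.
- have -> : rowsub (@lshift d d) M = a.
    by apply/matrixP => i j; rewrite mxE col_mxEu.
  by rewrite mulKVmx.
- have -> : rowsub s2 M = a - pid_mx r *m w.
    have pidE i j : (pid_mx r *m w) i j = if (i < r)%N then w i j else 0.
      rewrite mxE (bigD1 i) //= big1 ?addr0 => [|k /negPf ki].
        by rewrite mxE eqxx /=; case: ltnP; rewrite ?mul1r ?mul0r.
      by rewrite [pid_mx _ _ _]mxE -[_ == _]/(i == k) eq_sym ki mul0r.
    apply/matrixP => i j; rewrite mxE [RHS]mxE [X in _ = _ + X]mxE pidE /s2.
    case: ltnP => _; first by rewrite (col_mxEd a) !mxE.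
    by rewrite (col_mxEu a) subr0.
  rewrite mulmxBr mulKVmx // /w !mul_mx_row !mulmx0 mulmxA mulmx_ebase.
  by rewrite opp_row_mx add_row_mx oppr0 addr0 opprB addKr.
have [r0|r0] := posnP r.
  have s21 : s2 =1 @lshift d d by move=> i; rewrite /s2 r0.
  by rewrite (eq_imset _ s21).
have d0 : (0 < d)%N := leq_trans r0 (rank_leq_row A).
pose i0 := Ordinal d0.
(* For positive rank both inclusions fail at index 0: [s2] takes it to the second block, [s1] to the
   first. *)
transitivity false; last symmetry; apply/subsetPn.
  exists (s2 i0); first exact: imset_f.
  by apply/imsetP => -[j _ /eqP]; rewrite /s2 r0 eq_rlshift.
exists (lshift d i0); first exact: imset_f.
apply/imsetP => -[j _ /eqP]; rewrite /s2; case: ltnP => rj.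
  by rewrite eq_lrshift.
by rewrite eq_lshift => /eqP ij; rewrite -ij leqNgt r0 in rj.
Qed.

(** * Generators of the Derksen ideal as linear forms *)

Lemma xincl_lin_form (K : fieldType) (d : nat) (v : 'rV[K]_d) :
  xincl (lin_form v) = lin_form (row_mx v (0 : 'rV[K]_d)).
Proof.
rewrite /xincl linear_sum /lin_form big_split_ord /=.
rewrite [X in _ + X]big1 ?addr0 => [|i _]; last first.
  by rewrite row_mxEr mxE scale0r.
apply: eq_bigr => i _; rewrite row_mxEl linearZ /=.
by rewrite comp_mpolyXU -tnth_nth tnth_mktuple.
Qed.

Lemma graph_ideal_form (K : fieldType) (d : nat) (h : 'I_d -> {mpoly K[d]})
    (i : 'I_d) :
  (forall i, h i \is 1.-homog) ->
  yvar K i - xincl (h i) =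
  lin_form (row i (row_mx (- \matrix_(i, j) (h i)@_U_(j)) 1%:M)).
Proof.
move=> hh; rewrite row_row_mx row1 [RHS]/lin_form big_split_ord /= [LHS]addrC.
rewrite [in LHS](lin_form_homog1 (hh i)) xincl_lin_form /yvar.
rewrite [lin_form _]big_split_ord /= [X in - (_ + X)]big1 ?addr0.
  rewrite -sumrN; congr (_ + _).
    by apply: eq_bigr => j _; rewrite !row_mxEl !mxE scaleNr.
  rewrite (bigD1 i) //= row_mxEr mxE !eqxx scale1r big1 ?addr0 // => j ji.
  by rewrite row_mxEr mxE (negPf ji) scale0r.
by move=> j _; rewrite row_mxEr mxE scale0r.
Qed.

(* [act1] only covers actions on finite types. *)
Lemma action1 (aT : finGroupType) (T : Type) (to : {action aT &-> T}) (x : T) :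
  to x 1%g = x.
Proof.
have [inj_to toM] : is_action setT to by case: to.
by apply: (inj_to 1%g); rewrite -toM ?inE ?mulg1.
Qed.

(** * The group of order two *)

Theorem theorem3 (K : fieldType) (d : nat)
    (to : {action 'Z_2 &-> {mpoly K[d]}}) (Hto : linear_action to)
    (n : nat) (Hn : (1 <= n)%N) (f : {mpoly K[d + d]}) :
  symbolic_pow (Derksen_ideal to) n f <-> ideal_pow (Derksen_ideal to) n f.
Proof.
pose N g : 'M[K]_d := \matrix_(i, j) (to 'X_i g)@_U_(j).
have gensE g x : (exists i : 'I_d, x = yvar K i - xincl (to 'X_i g)) <->
    (exists i, x = lin_form (row i (row_mx (- N g) 1%:M))).
  have hh i : to 'X_i g \is 1.-homog by have [] := Hto g.
  have rowE i := graph_ideal_form (h := fun i => to 'X_i g) i hh.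
  by split=> -[i ->]; exists i; rewrite rowE.
have N1 : N 1%g = 1%:M.
  by apply/matrixP => i j; rewrite !mxE action1 mcoeffXU.
pose g1 : 'Z_2 := Zp1.
have [L [M [s1 [s2 [[Lu Mu] E1 E2 sE]]]]] := normal_form_graph (N g1).
apply: (two_subspaces_symbolic_pow Mu n f sE) => x.
(* The same [L] and [M] serve both group elements, so both primes are generated by variables of one
   coordinate system. *)
have IE g s : row_mx (- N g) 1%:M = L *m rowsub s M ->
    ideal_gen (fun x => exists i : 'I_d, x = yvar K i - xincl (to 'X_i g)) x <->
    order_ge (sub_order M [set s i | i in 'I_d]) 1 x.
  move=> BE; rewrite -(ideal_gen_sub_order Mu _ Lu BE).
  by split; apply: ideal_gen_sub; try exact: ideal_gen_ideal;
    move=> y /gensE Xy J _; apply.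
rewrite -(IE 1%g) ?N1 // -(IE g1) //; split=> [Dx|[I1 I2] g].
  by split; apply: Dx.
(* The intersection over the group has only two terms: [1%g] is the residue 0 and [g1] the residue
   1. *)
suff [->|->] : g = 1%g \/ g = g1; [exact: I1 | exact: I2 |].
by case: g => -[|[|//]] lt_g; [left | right]; apply: val_inj.
Qed.
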